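(* Let $X$ be a group. The function representation $\mathrm{End}_\lambda(\mathsf P(X))=\{\Phi_{\mathcal L}:\mathcal L\in\lambda(X)\}$ of $\lambda(X)$ consists exactly of all functions $\varphi:\mathsf P(X)\to\mathsf P(X)$ that are equivariant, monotone and symmetric.
   Context: $\mathsf P(X)$ is the power-set of the group $X$. A family $\mathcal L\subset\mathsf P(X)$ is linked if $A\cap B\neq\emptyset$ for all $A,B\in\mathcal L$, and maximal linked if it is linked and coincides with every linked family containing it; $\lambda(X)$ is the set of all maximal linked families on $X$. For a family $\mathcal A\subset\mathsf P(X)$ its function representation is $\Phi_{\mathcal A}:\mathsf P(X)\to\mathsf P(X)$, $\Phi_{\mathcal A}(A)=\{x\in X:x^{-1}A\in\mathcal A\}$. A function $\varphi:\mathsf P(X)\to\mathsf P(X)$ is equivariant if $\varphi(xA)=x\varphi(A)$ for all $x\in X$, $A\subset X$; monotone if $A\subset B$ implies $\varphi(A)\subset\varphi(B)$; symmetric if $\varphi(X\setminus A)=X\setminus\varphi(A)$ for all $A\subset X$. *)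

(* Defs.v *)
From mathcomp Require Import all_boot.
From mathcomp Require Import boolp classical_sets.

Set Implicit Arguments.
Unset Strict Implicit.
Unset Printing Implicit Defensive.

Local Open Scope classical_set_scope.

Definition linked (X : Type) (L : set (set X)) : Prop :=
  forall A B : set X, L A -> L B -> A `&` B !=set0.

Definition maximal_linked (X : Type) (L : set (set X)) : Prop :=
  linked L /\ forall M : set (set X), linked M -> L `<=` M -> L = M.

Definition lambda (X : Type) : set (set (set X)) :=
  [set L | maximal_linked L].
Arguments lambda : clear implicits.

Definition ltrans (X : groupType) (x : X) (A : set X) : set X :=
  [set (x * a)%g | a in A].

Definition Phi (X : groupType) (F : set (set X)) (A : set X) : set X :=
  [set x | F (ltrans x^-1%g A)].

Definition End_lambda (X : groupType) : set (set X -> set X) :=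
  [set Phi L | L in lambda X].
Arguments End_lambda : clear implicits.

Definition equivariant (X : groupType) (phi : set X -> set X) : Prop :=
  forall (x : X) (A : set X), phi (ltrans x A) = ltrans x (phi A).

Definition monotone_fun (X : Type) (phi : set X -> set X) : Prop :=
  forall A B : set X, A `<=` B -> phi A `<=` phi B.

Definition symmetric_fun (X : Type) (phi : set X -> set X) : Prop :=
  forall A : set X, phi (~` A) = ~` (phi A).

(* Main.v *)
(* A family on a nonempty set is maximal linked iff it is upward closed and
   contains exactly one of [A] and [~` A] for each [A]. Under [Phi] these two
   properties become monotonicity and symmetry, while equivariance is automatic;
   conversely an equivariant [phi] is recovered from the family of all [A] such
   that [phi A] contains the unit. *)
Require Import Defs.
From mathcomp Require Import all_boot.
From mathcomp Require Import boolp classical_sets.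

Local Open Scope classical_set_scope.

(** Adjoining [B] to [L] keeps the family linked, the pair [B], [B] being covered by [B !=set0];
    maximality then puts [B] in [L]. *)
Lemma maximal_linked_meets (X : Type) (L : set (set X)) (B : set X) :
  maximal_linked L -> B !=set0 -> (forall A, L A -> A `&` B !=set0) -> L B.
Proof.
move=> [linkL maxL] B0 meetB.
have -> : L = L `|` [set B]; last by right.
apply: maxL; last exact: subsetUl.
move=> C D [LC|->] [LD|->]; first exact: linkL.
- exact: meetB.
- by rewrite setIC; exact: meetB.
- by rewrite setIid.
Qed.

Lemma maximal_linked_subset (X : Type) (L : set (set X)) (A B : set X) :
  maximal_linked L -> A `<=` B -> L A -> L B.
Proof.
move=> maxL AB LA; have linkL := maxL.1.
apply: maximal_linked_meets => //.
  by have [x [Ax _]] := linkL _ _ LA LA; exists x; exact: AB.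
move=> C LC; have [x [Cx Ax]] := linkL _ _ LC LA.
by exists x; split=> //; exact: AB.
Qed.

Lemma maximal_linked_setC (X : Type) (x0 : X) (L : set (set X)) (A : set X) :
  maximal_linked L -> L (~` A) <-> ~ L A.
Proof.
move=> maxL; have linkL := maxL.1; split=> [LAC LA|nLA].
  by have [x [Ax]] := linkL _ _ LA LAC.
(* For empty [A] the complement is the whole type: it is inhabited by [x0] and meets every member of
   [L], since members are nonempty. *)
have [A0|/nonemptyPn A0] := pselect (A !=set0); last first.
  rewrite A0 setC0; apply: maximal_linked_meets => //; first by exists x0.
  by move=> C LC; rewrite setIT -(setIid C); exact: linkL.
(* A member [C] missing [A] would lie in [~] A[, forcing]~[A] into [L] by upward closure; so every
   member meets [A]. *)
apply: contrapT => nLAC; apply: nLA; apply: maximal_linked_meets => // C LC.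
apply: contrapT => /nonemptyPn/disjoints_subset CA.
exact/nLAC/(maximal_linked_subset _ _ _ _ maxL CA).
Qed.

Lemma maximal_linkedP (X : Type) (x0 : X) (L : set (set X)) :
  maximal_linked L <->
  (forall A B, A `<=` B -> L A -> L B) /\ (forall A, L (~` A) <-> ~ L A).
Proof.
split=> [maxL|[upL LC]].
  split=> [A B|A]; first exact: maximal_linked_subset.
  exact: maximal_linked_setC.
split=> [A B LA LB|M linkM LM].
  apply: contrapT => /nonemptyPn/disjoints_subset AB.
  by have /LC := upL _ _ AB LA.
(* A set of [M] outside [L] would have its complement in [L], hence in the linked family [M]. *)
apply/seteqP; split=> // A MA; apply: contrapT => /LC/LM MAC.
by have [x [Ax]] := linkM _ _ MA MAC.
Qed.

Section Translations.
Variable X : groupType.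
Implicit Types (x y : X) (A B : set X).

(** Membership in the image becomes a preimage condition, which reduces identities between
    translates to group computations. *)
Lemma ltransE x A y : ltrans x A y = A (x^-1 * y)%g.
Proof.
apply/propext; split=> [[a Aa <-]|Axy]; first by rewrite mulKg.
by exists (x^-1 * y)%g => //; rewrite mulVKg.
Qed.

Lemma ltransM x y A : ltrans (x * y)%g A = ltrans x (ltrans y A).
Proof. by apply/funext => z; rewrite !ltransE invgM mulgA. Qed.

Lemma ltransC x A : ltrans x (~` A) = ~` ltrans x A.
Proof. by apply/funext => z; rewrite /setC /mkset !ltransE. Qed.

Lemma ltransS x A B : A `<=` B -> ltrans x A `<=` ltrans x B.
Proof. by move=> AB z; rewrite !ltransE; exact: AB. Qed.

Lemma Phi_equivariant (F : set (set X)) : equivariant (Phi F).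
Proof.
by move=> x A; apply/funext => y; rewrite ltransE /Phi/= invgM invgK ltransM.
Qed.

Lemma Phi_unit (phi : set X -> set X) :
  equivariant phi -> Phi [set A | phi A 1%g] = phi.
Proof.
move=> phiE; apply/funext => A; apply/funext => x.
by rewrite /Phi/= phiE ltransE invgK mulg1.
Qed.

End Translations.

Theorem corollary4p4 (X : groupType) :
  End_lambda X =
  [set phi : set X -> set X |
    [/\ equivariant phi, monotone_fun phi & symmetric_fun phi]].
Proof.
apply/seteqP; split=> [_ [L /(maximal_linkedP _ 1%g) [upL LC] <-]|phi].
  split=> [|A B AB x|A]; first exact: Phi_equivariant.
    exact/upL/ltransS.
  by apply/seteqP; split=> x; rewrite /Phi/= ltransC => /LC.
move=> [phiE phiM phiC]; exists [set A | phi A 1%g]; last exact: Phi_unit.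
(* The unit also serves as the point showing that [X] is nonempty. *)
apply/(maximal_linkedP _ 1%g); split=> [A B AB|A]; first exact: phiM.
by rewrite /= phiC.
Qed.
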